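(* Let $M=US$ be a $(U,S)$-proper monoid, where $U$ and $S$ are submonoids, and suppose $P=\langle S^+\rangle$ is central in $U$ (that is, $pu=up$ for all $p\in P$, $u\in U$). Then there exist a monoid $\mathcal U$, a semidirect product $\mathcal M=\mathcal U\rtimes(S/\sigma)$ and an embedding $\psi:M\to\mathcal M$ such that: (i) $\mathcal U$ contains a subsemigroup $U'$ isomorphic to $U$; (ii) $\psi|_U:U\to U'\times\{\widehat 1\}$ (the subsemigroup $U'\rtimes\{\widehat1\}$ of $\mathcal M$) is an isomorphism; (iii) $\mathcal U$ is commutative if $U$ is commutative.
   Context: For a subsemigroup $U$ of a monoid $M$ with identity $1$, $U^1=U\cup\{1\}$. An action pair in $M$ is a pair $(U,S)$ of subsemigroups of $M$ together with a left action $(s,u)\mapsto{}^su$ of $S$ on $U^1$ by semigroup morphisms (${}^s({}^tu)={}^{st}u$, ${}^s(uv)={}^su\cdot{}^sv$) such that (A1) $s\cdot u={}^su\cdot s$ for all $s\in S,u\in U^1$, and (A2) $us=vt\Rightarrow u\cdot{}^s1=v\cdot{}^t1$ for all $u,v\in U^1$, $s,t\in S$. Write $s^+={}^s1$, $S^+=\{s^+:s\in S\}$, and let $P=\langle S^+\rangle$ be the subsemigroup of $U^1$ generated by $S^+$. Let $\kappa=\{(s,t)\in S\times S:ps=qt\text{ for some }p,q\in P\}$ and let $\sigma=\kappa^\sharp$ be the congruence on $S$ generated by $\kappa$. The $\sigma$-class of $s\in S$ is denoted $\widehat s$. The pair $(U,S)$ is proper if for all $u,v\in U^1$, $s,t\in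 S$: $us=vt\iff us^+=vt^+$ and $s\mathrel\sigma t$. ''$M=US$ is a $(U,S)$-proper monoid'' means: $(U,S)$ is a proper action pair in the monoid $M$, $U$ and $S$ are both submonoids of $M$, and $M=US=\{us:u\in U,s\in S\}$. A semidirect product $\mathcal U\rtimes T$ of a monoid $\mathcal U$ and a semigroup $T$ is formed from a left action of $T$ on $\mathcal U$ by semigroup morphisms, with product $(u,s)(v,t)=(u\cdot{}^sv,st)$ on the set $\mathcal U\times T$. An embedding is an injective semigroup morphism. *)

(* Defs.v *)
From HB Require Import structures.
From mathcomp Require Import all_boot.
From mathcomp Require Import boolp classical_sets.

Set Implicit Arguments.
Unset Strict Implicit.
Unset Printing Implicit Defensive.

Local Open Scope classical_set_scope.
Local Open Scope group_scope.
Local Open Scope quotient_scope.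

Record subsemigroup (M : semigroupType) := Subsemigroup {
  sg_set : set M;
  sg_mulP : forall x y : M, sg_set x -> sg_set y -> sg_set (x * y) }.

Definition sg_sort (M : semigroupType) (A : subsemigroup M) : Type :=
  set_type (sg_set A).
Coercion sg_sort : subsemigroup >-> Sortclass.

Section SubsemigroupType.
Variables (M : semigroupType) (A : subsemigroup M).

Lemma sg_mulg_closed : mulg_closed (fun x : M => x \in sg_set A).
Proof.
by move=> x y /set_mem Ax /set_mem Ay; apply/mem_set/sg_mulP.
Qed.

HB.instance Definition _ := SubChoice.on (sg_sort A).
HB.instance Definition _ :=
  SubChoice_isSubSemigroup.Build M (fun x : M => x \in sg_set A) (sg_sort A)
    sg_mulg_closed.

Definition sg_elt (x : M) (Ax : sg_set A x) : A := Sub x (mem_set Ax).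

End SubsemigroupType.

Definition sg_isomorphic (A B : semigroupType) : Prop :=
  exists f : {multiplicative A -> B}, bijective f.

Section Adjoin1.
Variables (M : monoidType) (U : subsemigroup M).

Lemma adj1_subproof (x y : M) :
  (sg_set U `|` [set 1]) x -> (sg_set U `|` [set 1]) y ->
  (sg_set U `|` [set 1]) (x * y).
Proof.
move=> [Ux|->] [Uy|->]; rewrite ?mul1g ?mulg1; [|by left|by left|by right].
by left; apply: sg_mulP.
Qed.

(* [1] is the identity of [M], so [adj1 U] is [U] as soon as [1] is in [U],
   even if [U] has an identity element of its own. *)
Definition adj1 : subsemigroup M := Subsemigroup adj1_subproof.

Definition adj1_one : adj1 := @sg_elt M adj1 1 (or_intror erefl).

End Adjoin1.

Record congruence (T : semigroupType) := Congruence {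
  cong_rel :> T -> T -> Prop;
  cong_refl : forall x, cong_rel x x;
  cong_sym : forall x y, cong_rel x y -> cong_rel y x;
  cong_trans : forall x y z, cong_rel x y -> cong_rel y z -> cong_rel x z;
  cong_mul : forall x y z t,
    cong_rel x y -> cong_rel z t -> cong_rel (x * z) (y * t) }.

Section CongruenceGenerated.
Variables (T : semigroupType) (K : T -> T -> Prop).

Definition cgen_rel (x y : T) : Prop :=
  forall C : congruence T, (forall a b, K a b -> C a b) -> C x y.

Lemma cgen_refl x : cgen_rel x x.
Proof. by move=> C _; apply: cong_refl. Qed.

Lemma cgen_sym x y : cgen_rel x y -> cgen_rel y x.
Proof. by move=> xy C KC; apply/cong_sym/xy. Qed.

Lemma cgen_trans x y z : cgen_rel x y -> cgen_rel y z -> cgen_rel x z.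
Proof. by move=> xy yz C KC; apply: cong_trans (xy C KC) (yz C KC). Qed.

Lemma cgen_mul x y z t :
  cgen_rel x y -> cgen_rel z t -> cgen_rel (x * z) (y * t).
Proof. by move=> xy zt C KC; apply: cong_mul (xy C KC) (zt C KC). Qed.

Definition cgen : congruence T :=
  Congruence cgen_refl cgen_sym cgen_trans cgen_mul.

End CongruenceGenerated.

Section Quotient.
Variables (T : semigroupType) (C : congruence T).

Definition cong_bool (x y : T) : bool := `[< C x y >].

Lemma cong_bool_equiv : equiv_class_of cong_bool.
Proof.
split.
- by move=> x; apply/asboolP/cong_refl.
- by move=> x y; apply/asboolP/asboolP => /cong_sym.
- move=> y x z /asboolP xy /asboolP yz.
  by apply/asboolP/(cong_trans xy yz).
Qed.

Canonical cong_equiv := EquivRelPack cong_bool_equiv.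

Definition cquot : Type := {eq_quot cong_equiv}.
HB.instance Definition _ := Choice.on cquot.
HB.instance Definition _ := EqQuotient.on cquot.

Definition cclass (x : T) : cquot := \pi_cquot x.

Lemma cclassP x y : cclass x = cclass y <-> C x y.
Proof.
split=> [/eqP|xy]; first by rewrite /cclass eqmodE => /asboolP.
by apply/eqP; rewrite /cclass eqmodE; apply/asboolP.
Qed.

Lemma cclass_repr (a : cquot) : cclass (repr a) = a.
Proof. exact: reprK. Qed.

Definition cquot_mul (a b : cquot) : cquot := cclass (repr a * repr b).

Lemma cclassM x y : cquot_mul (cclass x) (cclass y) = cclass (x * y).
Proof. by apply/cclassP/cong_mul; apply/cclassP; rewrite cclass_repr. Qed.

Lemma cquot_mulA : associative cquot_mul.
Proof.
move=> a b c; rewrite -(cclass_repr a) -(cclass_repr b) -(cclass_repr c).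
by rewrite !cclassM mulgA.
Qed.

HB.instance Definition _ := isSemigroup.Build cquot cquot_mulA.
HB.instance Definition _ :=
  isMultiplicative.Build T cquot cclass (fun x y => esym (cclassM x y)).

End Quotient.

(* No unitality is required, even when [T] and [U] have identity elements. *)
Record sgAction (T U : semigroupType) := SgAction {
  sga_fun :> T -> U -> U;
  sga_comp : forall s t u, sga_fun s (sga_fun t u) = sga_fun (s * t) u;
  sga_mul : forall s u v, sga_fun s (u * v) = sga_fun s u * sga_fun s v }.

Section SemidirectProduct.
Variables (U : monoidType) (T : semigroupType).

(* The unused argument keys the semigroup structure on the action. *)
Definition sdprod (act : sgAction T U) : Type := (U * T)%type.

Variable act : sgAction T U.

HB.instance Definition _ := Choice.copy (sdprod act) (U * T)%type.

Definition sdprod_mul (x y : sdprod act) : sdprod act :=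
  (x.1 * act x.2 y.1, x.2 * y.2).

Lemma sdprod_mulA : associative sdprod_mul.
Proof.
move=> [u r] [v s] [w t]; rewrite /sdprod_mul /=.
by rewrite sga_mul sga_comp !mulgA.
Qed.

HB.instance Definition _ := isSemigroup.Build (sdprod act) sdprod_mulA.

End SemidirectProduct.

Section ActionPair.
Variables (M : monoidType) (U S : subsemigroup M) (act : sgAction (sg_sort S) (sg_sort (adj1 U))).

Definition action_pair : Prop :=
  (forall (s : S) (u : adj1 U), \val s * \val u = \val (act s u) * \val s) /\
  (forall (u v : adj1 U) (s t : S), \val u * \val s = \val v * \val t ->
     u * act s (adj1_one U) = v * act t (adj1_one U)).

Definition splus (s : S) : adj1 U := act s (adj1_one U).

Definition Pset : set (adj1 U) :=
  smallest (fun A : set (adj1 U) => forall x y, A x -> A y -> A (x * y))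
    (range splus).

Definition kappa (s t : S) : Prop :=
  exists p q : adj1 U,
    [/\ Pset p, Pset q & \val p * \val s = \val q * \val t].

Definition sigma : congruence (sg_sort S) := cgen kappa.

Definition proper : Prop :=
  forall (u v : adj1 U) (s t : S),
    \val u * \val s = \val v * \val t <->
    u * splus s = v * splus t /\ sigma s t.

(* That [(U, S)] is an action pair is part of being a proper monoid. *)
Definition proper_monoid : Prop :=
  [/\ action_pair, proper, sg_set U 1, sg_set S 1
    & forall m : M, exists (u : U) (s : S), m = \val u * \val s].

Lemma proper_monoid_S1 : proper_monoid -> sg_set S 1.
Proof. by case. Qed.

End ActionPair.

(* Main.v *)
Require Import Defs.
From HB Require Import structures.
From mathcomp Require Import all_boot.
From mathcomp Require Import boolp classical_sets.

(** Write [^su] for the action and [T] for [S/sigma].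

    The target monoid consists of all functions [T -> set U^1], multiplied
    pointwise by the product of subsets.  It is commutative as soon as [U] is,
    and [T] acts on it by right translation of the argument,
    [(^t F)(x) = F (x t)], so no action of [T] on [U] is needed.

    An element [m = us] of [M] has a well-defined core [u s^+] and a
    well-defined grade, the class of [s]; together they determine [m], because
    the pair is proper.  The embedding sends [m] to its grade together with its
    spread, the function whose value at [x] is the set of all [p (^r core)]
    with [p] in [P] and [r] in the class [x].  Thus the ambiguity in lifting a
    class [x] to an element of [S] is absorbed by taking every lift at once.

    The multiplication is respected thanks to a single identity: if [a] and [b]
    are [sigma]-related, then [b^+ (^a w) = a^+ (^b w)] for every [w]
    ([sigma_twist]).  So two lifts of the same class act in the same way up to
    factors of [P].  Such factors are harmless inside a spread, because [P] is
    central.  Injectivity uses the same identity at [b = 1]: the spread of [m]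
    at the class of [1] is the set [P (core m)], and [P], being generated by
    commuting idempotents, is a semilattice, so [P c] determines [c]. *)

Set Implicit Arguments.
Unset Strict Implicit.
Unset Printing Implicit Defensive.

Local Open Scope classical_set_scope.
Local Open Scope group_scope.

(** * Subsemigroups as images of injective morphisms *)

Lemma inj_surj_bijective (A B : Type) (f : A -> B) :
  injective f -> (forall b, exists a, f a = b) -> bijective f.
Proof.
move=> injf /choice[g fgK].
by exists g => // a; apply: injf; rewrite fgK.
Qed.

Lemma range_mul (A B : semigroupType) (f : A -> B) :
  {morph f : x y / x * y} ->
  forall x y, range f x -> range f y -> range f (x * y).
Proof. by move=> fM _ _ [a _ <-] [b _ <-]; exists (a * b). Qed.

Lemma sgvalM (B : semigroupType) (W : subsemigroup B) (x y : W) :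
  \val (x * y) = \val x * \val y.
Proof. exact: gmulfM. Qed.

(** This produces both the isomorphism of [U] with [U'] and the one of [U] with
    the subsemigroup of the semidirect product lying over the class of [1]. *)
Lemma corestrict_iso (A B : semigroupType) (f : A -> B) (W : subsemigroup B) :
  {morph f : x y / x * y} -> injective f -> sg_set W = range f ->
  exists g : {multiplicative A -> W},
    bijective g /\ forall a, \val (g a) = f a.
Proof.
move=> fM injf Wf.
have Wfa a : sg_set W (f a) by rewrite Wf; exists a.
pose g a : W := sg_elt (Wfa a).
have valg a : \val (g a) = f a by rewrite SubK.
have gM : {morph g : x y / x * y}.
  by move=> x y; apply: val_inj; rewrite sgvalM !valg fM.
pose gmul := isMultiplicative.Build A W g gM.
exists (HB.pack g gmul : {multiplicative A -> W}); split=> //=.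
apply: inj_surj_bijective => [x y gxy|w].
  by apply: injf; rewrite -!valg gxy.
have : range f (\val w) by rewrite -Wf; apply/set_mem/valP.
move=> [a _ faw].
by exists a; apply: val_inj; rewrite valg.
Qed.

(** * The adjoined identity *)

Section AdjoinedMonoid.
Variables (M : monoidType) (U : subsemigroup M).

Lemma val_adj1_one : \val (adj1_one U) = 1.
Proof. exact: SubK. Qed.

Lemma adj1_mul1g : left_id (adj1_one U) *%g.
Proof. by move=> u; apply: val_inj; rewrite sgvalM val_adj1_one mul1g. Qed.

Lemma adj1_mulg1 : right_id (adj1_one U) *%g.
Proof. by move=> u; apply: val_inj; rewrite sgvalM val_adj1_one mulg1. Qed.

HB.instance Definition _ :=
  Semigroup_isMonoid.Build (sg_sort (adj1 U)) adj1_mul1g adj1_mulg1.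

Lemma adj1_commute :
  (forall u v : U, commute u v) -> forall x y : adj1 U, commute x y.
Proof.
move=> cU x y; apply: val_inj; rewrite !sgvalM.
have [Ux|->] := set_mem (valP x); last by rewrite mul1g mulg1.
have [Uy|->] := set_mem (valP y); last by rewrite mul1g mulg1.
by have /(congr1 \val) := cU (sg_elt Ux) (sg_elt Uy); rewrite !sgvalM !SubK.
Qed.

End AdjoinedMonoid.

(** * Set-valued functions and right translation *)

Section SetFunctions.
Variables (T : semigroupType) (V : monoidType).

Definition setfun : Type := T -> set V.

HB.instance Definition _ := Choice.copy setfun (T -> set V).

Definition setfun_mul (F G : setfun) : setfun :=
  fun t => [set u * v | u in F t & v in G t].

Definition setfun_one : setfun := fun=> [set 1].

Lemma setfun_mulA : associative setfun_mul.
Proof.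
move=> F G H; apply/funext => t; apply/seteqP; split=> w.
  move=> [u Fu [_ [v Gv [z Hz <-]] <-]]; rewrite mulgA.
  by exists (u * v); [exists u => //; exists v | exists z].
move=> [_ [u Fu [v Gv <-]] [z Hz <-]]; rewrite -mulgA.
by exists u => //; exists (v * z) => //; exists v => //; exists z.
Qed.

Lemma setfun_mul1g : left_id setfun_one setfun_mul.
Proof.
move=> F; apply/funext => t; apply/seteqP; split=> w.
  by move=> [_ -> [v Fv <-]]; rewrite mul1g.
by move=> Fw; exists 1 => //; exists w => //; rewrite mul1g.
Qed.

Lemma setfun_mulg1 : right_id setfun_one setfun_mul.
Proof.
move=> F; apply/funext => t; apply/seteqP; split=> w.
  by move=> [v Fv [_ -> <-]]; rewrite mulg1.
by move=> Fw; exists w => //; exists 1 => //; rewrite mulg1.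
Qed.

HB.instance Definition _ :=
  isMonoid.Build setfun setfun_mulA setfun_mul1g setfun_mulg1.

Lemma setfun_commute :
  (forall u v : V, commute u v) -> forall F G : setfun, commute F G.
Proof.
move=> cV F G; apply/funext => t; apply/seteqP.
by split=> _ [u Fu [v Gv <-]]; exists v => //; exists u => //; apply: cV.
Qed.

Definition translate (t : T) (F : setfun) : setfun := fun x => F (x * t).

Lemma translate_comp s t F :
  translate s (translate t F) = translate (s * t) F.
Proof. by apply/funext => x; rewrite /translate mulgA. Qed.

Lemma translateM s F G :
  translate s (F * G) = translate s F * translate s G.
Proof. by []. Qed.

Definition translation : sgAction T setfun :=
  SgAction translate_comp translateM.

End SetFunctions.

(** * Proper monoids in which [P] is central *)

Section ProperMonoid.
Variables (M : monoidType) (U S : subsemigroup M).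
Variable act : sgAction (sg_sort S) (sg_sort (adj1 U)).
Hypothesis hM : proper_monoid act.
Hypothesis hP : forall (p : adj1 U) (u : U),
  Pset act p -> \val p * \val u = \val u * \val p.

Local Notation V := (sg_sort (adj1 U)).
Local Notation T := (cquot (sigma act)).
Local Notation plus := (splus act).
Local Notation P := (Pset act).
Local Notation cls := (cclass (sigma act)).

Let oneS : S := sg_elt (proper_monoid_S1 hM).

Lemma val_oneS : \val oneS = 1.
Proof. exact: SubK. Qed.

Lemma oneS_mulr s : s * oneS = s.
Proof. by apply: val_inj; rewrite sgvalM val_oneS mulg1. Qed.

Lemma clsM s t : cls (s * t) = cls s * cls t.
Proof. exact: gmulfM. Qed.

Lemma mul_cls_oneS (x : T) : x * cls oneS = x.
Proof. by rewrite -(cclass_repr x) -clsM oneS_mulr. Qed.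

Lemma act_commute s (u : V) : \val s * \val u = \val (act s u) * \val s.
Proof. by case: hM => -[A1 _] _ _ _ _; apply: A1. Qed.

Lemma act_cancel (u v : V) s t :
  \val u * \val s = \val v * \val t -> u * plus s = v * plus t.
Proof. by case: hM => -[_ A2] _ _ _ _; apply: A2. Qed.

Lemma properE (u v : V) s t :
  \val u * \val s = \val v * \val t <->
  u * plus s = v * plus t /\ sigma act s t.
Proof. by case: hM => _ + _ _ _; apply. Qed.

Lemma act_plusr s u : act s u * plus s = act s u.
Proof. by rewrite -sga_mul mulg1. Qed.

Lemma act_plusl s u : plus s * act s u = act s u.
Proof. by rewrite -sga_mul mul1g. Qed.

Lemma plus_idem s : plus s * plus s = plus s.
Proof. exact: act_plusr. Qed.

Lemma plusM s t : plus (s * t) = act s (plus t).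
Proof. by rewrite /splus sga_comp. Qed.

Lemma act_oneS u : act oneS u = u.
Proof.
apply: val_inj; have := act_commute oneS u.
by rewrite val_oneS mul1g mulg1.
Qed.

Lemma plus_oneS : plus oneS = 1.
Proof. exact: act_oneS. Qed.

Lemma P_plus s : P (plus s).
Proof. by apply: sub_gen_smallest; exists s. Qed.

Lemma P_mul p q : P p -> P q -> P (p * q).
Proof. by move=> Pp Pq A [AM gA]; apply: (AM); [apply: Pp|apply: Pq]. Qed.

Lemma P_one : P 1.
Proof. by rewrite -plus_oneS; apply: P_plus. Qed.

Lemma P_central p (u : V) : P p -> p * u = u * p.
Proof.
move=> Pp; apply: val_inj; rewrite !sgvalM.
have [Uu|->] := set_mem (valP u); last by rewrite mul1g mulg1.
by have := hP (sg_elt Uu) Pp; rewrite SubK.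
Qed.

Lemma P_idem p : P p -> p * p = p.
Proof.
move=> Pp; suff [] : (P `&` [set q | q * q = q]) p by [].
apply: Pp; split=> [x y [Px xx] [Py yy]|_ [s _ <-]].
  split; first exact: P_mul.
  by rewrite /= mulgA -(mulgA x y) (P_central x Py) mulgA xx -mulgA yy.
by split; [apply: P_plus | apply: plus_idem].
Qed.

(** Properness, applied to the coefficients [b^+] and [a^+], says that
    [b^+ a = a^+ b]; moving [w] through both sides and cancelling gives the
    result. *)
Lemma sigma_twist a b (w : V) :
  sigma act a b -> plus b * act a w = plus a * act b w.
Proof.
move=> ab.
have ba : \val (plus b) * \val a = \val (plus a) * \val b.
  by apply/properE; split=> //; exact: P_central _ (P_plus b).
have : (plus b * act a w) * plus a = (plus a * act b w) * plus b.
  apply: act_cancel; rewrite !sgvalM -!mulgA -!act_commute.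
  by rewrite !mulgA ba.
by rewrite -!mulgA !act_plusr.
Qed.

Lemma act_sigma_oneS r (w : V) : sigma act r oneS -> act r w = plus r * w.
Proof. by move=> /(sigma_twist w); rewrite plus_oneS mul1g act_oneS. Qed.

(** * Core and grade *)

Lemma decomposition_ex (m : M) :
  exists us : V * S, m = \val us.1 * \val us.2.
Proof.
case: hM => _ _ _ _ /(_ m)[u [s ->]].
exists (@sg_elt M (adj1 U) (\val u) (or_introl (set_mem (valP u))), s).
by rewrite SubK.
Qed.

Definition decomposition (m : M) : V * S := projT1 (cid (decomposition_ex m)).

Lemma decompositionK m :
  \val (decomposition m).1 * \val (decomposition m).2 = m.
Proof. by rewrite /decomposition; case: cid => us /= ->. Qed.

Definition core (m : M) : V :=
  (decomposition m).1 * plus (decomposition m).2.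

Definition grade (m : M) : T := cls (decomposition m).2.

Lemma coreE (u : V) s : core (\val u * \val s) = u * plus s.
Proof. exact/act_cancel/decompositionK. Qed.

Lemma gradeE (u : V) s : grade (\val u * \val s) = cls s.
Proof.
by apply/cclassP; have /properE[] := decompositionK (\val u * \val s).
Qed.

Lemma core_grade_inj m n : core m = core n -> grade m = grade n -> m = n.
Proof.
move=> cmn /cclassP gmn; rewrite -(decompositionK m) -(decompositionK n).
exact/properE.
Qed.

Lemma mul_decomposition (u v : V) s t :
  \val u * \val s * (\val v * \val t) = \val (u * act s v) * \val (s * t).
Proof. by rewrite !sgvalM mulgA -(mulgA (\val u)) act_commute !mulgA. Qed.

Lemma core_mul (u : V) s n :
  core (\val u * \val s * n) = core (\val u * \val s) * act s (core n).
Proof.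
rewrite -{1}(decompositionK n) mul_decomposition !coreE plusM.
by rewrite -!mulgA act_plusl -sga_mul.
Qed.

Lemma grade_mul m n : grade (m * n) = grade m * grade n.
Proof.
rewrite -(decompositionK m) -(decompositionK n) mul_decomposition !gradeE.
exact: clsM.
Qed.

(** * The spread of an element and the embedding *)

Definition spread (m : M) : setfun T V :=
  fun x => [set w | exists p r,
                      [/\ P p, cls r = x & w = p * act r (core m)]].

(** A product of points of the two factors combines a lift [r] of [x] with an
    arbitrary lift [q] of the class of [r s]; [sigma_twist] trades [q] for the
    lift [r s] at the price of the factor [q^+] of [P].  The factor [(rs)^+]
    that the trade consumes is supplied by [^r(u s^+)]. *)
Lemma spread_mul m n :
  spread (m * n) = spread m * translate (grade m) (spread n).
Proof.
rewrite -(decompositionK m).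
move: (decomposition m).1 (decomposition m).2 => u s.
apply/funext => x; apply/seteqP; split=> w.
  move=> [p [r [Pp rx ->]]]; exists (p * act r (core (\val u * \val s))).
    by exists p, r.
  exists (1 * act (r * s) (core n)); last first.
    by rewrite core_mul mul1g (sga_mul _ r (core _)) sga_comp mulgA.
  exists 1, (r * s); split=> //; first exact: P_one.
  by rewrite clsM rx gradeE.
move=> [_ [p [r [Pp rx ->]]] [_ [p' [q [Pp' + ->]]] <-]].
rewrite gradeE -rx -clsM => /cclassP /(sigma_twist (core n)) twist.
exists (p * p' * plus q), r; split=> //.
  by apply: P_mul; [apply: P_mul | apply: P_plus].
rewrite core_mul (sga_mul _ r (core _)) sga_comp coreE.
have plus_rs : act r (u * plus s) = act r (u * plus s) * plus (r * s).
  by rewrite sga_mul -plusM -mulgA plus_idem.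
move: (act r (u * plus s)) plus_rs => y y_rs.
rewrite {1}y_rs -!mulgA (mulgA (plus (r * s)) p') -(P_central _ Pp').
rewrite -mulgA twist (mulgA y p') -(P_central y Pp') -mulgA.
by rewrite (mulgA y (plus q)) -(P_central y (P_plus q)) -mulgA.
Qed.

Lemma spread_oneS_sub m n : spread m = spread n ->
  exists2 p, P p & core m = p * core n.
Proof.
move=> mn; have : spread m (cls oneS) (core m).
  by exists 1, oneS; rewrite act_oneS mul1g; split=> //; apply: P_one.
rewrite mn => -[p [r [Pp /cclassP r1 ->]]]; exists (p * plus r).
  by apply: P_mul => //; apply: P_plus.
by rewrite act_sigma_oneS // mulgA.
Qed.

Lemma spread_core m n : spread m = spread n -> core m = core n.
Proof.
move=> mn; have [p Pp cm] := spread_oneS_sub mn.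
have [q Pq cn] := spread_oneS_sub (esym mn).
have qm : q * core m = core m.
  (* [q] fixes [core n = q (core m)], hence also [core m = p (core n)]. *)
  by rewrite cm mulgA (P_central p Pq) -mulgA {1}cn (mulgA q q) (P_idem Pq) -cn.
by rewrite cn qm.
Qed.

Definition embed (m : M) : sdprod (translation T V) := (spread m, grade m).

Lemma embedM : {morph embed : m n / m * n}.
Proof.
by move=> m n; congr pair; [apply: spread_mul | apply: grade_mul].
Qed.

Lemma embed_inj : injective embed.
Proof.
by move=> m n [smn gmn]; apply: core_grade_inj => //; apply: spread_core.
Qed.

(** * The copy of [U] *)

Lemma grade_U (u : U) : grade (\val u) = cls oneS.
Proof.
have Uu : sg_set (adj1 U) (\val u) by left; apply/set_mem/valP.
by have := gradeE (sg_elt Uu) oneS; rewrite val_oneS mulg1 SubK.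
Qed.

Definition spreadU (u : U) : setfun T V := spread (\val u).

Lemma spreadUM : {morph spreadU : u v / u * v}.
Proof.
move=> u v; rewrite /spreadU sgvalM spread_mul grade_U; congr (_ * _).
by apply/funext => x; rewrite /translate mul_cls_oneS.
Qed.

Lemma spreadU_inj : injective spreadU.
Proof.
move=> u v uv; apply/val_inj/embed_inj.
by congr pair; rewrite ?grade_U.
Qed.

End ProperMonoid.

(** * The embedding theorem *)

Theorem theorem5p47 (M : monoidType) (U S : subsemigroup M)
    (act : sgAction (sg_sort S) (sg_sort (adj1 U))) (hM : proper_monoid act)
    (hP : forall (p : adj1 U) (u : U),
       Pset act p -> \val p * \val u = \val u * \val p) :
  exists (UU : monoidType) (a : sgAction (cquot (sigma act)) UU)
         (psi : {multiplicative M -> sdprod a}) (U' : subsemigroup UU)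
         (W : subsemigroup (sdprod a)),
    [/\ injective psi,
        sg_isomorphic (sg_sort U) (sg_sort U'),
        sg_set W = [set x : sdprod a | sg_set U' x.1 /\
                      x.2 = cclass (sigma act) (sg_elt (proper_monoid_S1 hM))],
        exists g : {multiplicative U -> W},
          bijective g /\ forall u : U, \val (g u) = psi (\val u)
      & (forall u v : U, commute u v) -> forall x y : UU, commute x y].
Proof.
pose fU (u : U) := embed hM (\val u).
have fUM : {morph fU : u v / u * v}.
  by move=> u v; rewrite /fU sgvalM; apply: embedM.
pose U' := Subsemigroup (range_mul (spreadUM hM hP)).
pose W := Subsemigroup (range_mul fUM).
pose embed_mul := isMultiplicative.Build _ _ (embed hM) (embedM hM hP).
pose psi := HB.pack_for
  {multiplicative M -> sdprod (translation (cquot (sigma act)) (adj1 U))}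
  (embed hM) embed_mul.
exists (setfun (cquot (sigma act)) (adj1 U)), (translation _ _), psi, U', W.
split.
- exact: embed_inj hP.
- have [g [bg _]] := corestrict_iso (W := U') (spreadUM hM hP)
    (@spreadU_inj _ _ _ _ hM hP) erefl.
  by exists g.
- apply/seteqP; split=> [_ [u _ <-]|[F x] [/= [u _ uF] ->]].
    by split; [exists u | apply: grade_U].
  by exists u => //; congr pair; [exact: uF | apply: grade_U].
- by apply: corestrict_iso => // u v /(embed_inj hP) /val_inj.
- by move=> cU; apply/setfun_commute/adj1_commute.
Qed.
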